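(* Let $n>0$, let $a_1,\dots,a_n$ be real numbers and $\alpha\in\mathbb{R}$. For a segment $[i,j]=\{i,\dots,j\}$ with $1\le i\le j\le n$, its score is $a(i,j)=a_i+\dots+a_j$ and its length is $j-i+1$. Algorithm LongestSegment (described below) runs in $O(n)$ time and returns a segment $[i,j]$ of maximum length among all segments with $a(i,j)\ge\alpha$, or $\mathsf{nil}$ if no segment has score at least $\alpha$.
   Context: Algorithm LongestSegment, on input $a_1,\dots,a_n$ and $\alpha$: 1. Set $f_0\leftarrow 0$ and for $i=1,\dots,n$ set $f_i\leftarrow f_{i-1}+a_i$. 2. Set $k\leftarrow1$, $l_1\leftarrow 0$; for $i=1,\dots,n$: if $f_i<f_{l_k}$ then $k\leftarrow k+1$, $l_k\leftarrow i$. 3. Set $m\leftarrow 1$, $r_1\leftarrow n$; for $j=n,n-1,\dots,1$: if $f_j>f_{r_m}$ then $m\leftarrow m+1$, $r_m\leftarrow j$. 4. Set $\mathsf{max}\leftarrow 0$, $\mathsf{segment}\leftarrow\mathsf{nil}$, $i\leftarrow 1$, $j\leftarrow m$. 5. While $i\le k$ and $j\ge 1$: (a) while $i\le k$ and $f_{l_i}+\alpha>f_{r_j}$, set $i\leftarrow i+1$; (b) if $i\le k$, then while $j\ge1$ and $f_{l_i}+\alpha\le f_{r_j}$: if $r_j-l_i>\mathsf{max}$ then set $\mathsf{max}\leftarrow r_j-l_i$ and $\mathsf{segment}\leftarrow[l_i+1,r_j]$; then set $j\leftarrow j-1$. 6. Return $\mathsf{segment}$. Running time counts arithmetic operations and comparisons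 on reals as unit cost. *)

(* Defs.v *)
From HB Require Import structures.
From mathcomp Require Import all_boot all_order all_algebra.
From mathcomp Require Import reals.

Set Implicit Arguments.
Unset Strict Implicit.
Unset Printing Implicit Defensive.

Import Order.TTheory GRing.Theory Num.Theory.
Local Open Scope ring_scope.

(** ** Segments *)

(* The input a_1, ..., a_n is a function on 'I_n whose value at t is a_(t+1);
   segments and array indices are 1-based throughout. *)

Definition segment (n i j : nat) : bool := (1 <= i <= j)%N && (j <= n)%N.

Definition score (R : realDomainType) (n : nat) (a : 'I_n -> R) (i j : nat) : R :=
  \sum_(t < n | (i <= t.+1 <= j)%N) a t.

Definition seg_length (i j : nat) : nat := (j - i + 1)%N.

Definition longest_segment (R : realDomainType) (n : nat) (a : 'I_n -> R)
    (alpha : R) (i j : nat) : Prop :=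
  [/\ segment n i j, alpha <= score a i j
    & forall i' j' : nat, segment n i' j' -> alpha <= score a i' j' ->
        (seg_length i' j' <= seg_length i j)%N].

(* [None] stands for nil. *)
Definition correct_answer (R : realDomainType) (n : nat) (a : 'I_n -> R)
    (alpha : R) (out : option (int * int)) : Prop :=
  (exists i j : nat, out = Some (i%:Z, j%:Z) /\ longest_segment a alpha i j)
  \/ (out = None
      /\ ~ exists i j : nat, segment n i j /\ alpha <= score a i j).

(** ** A while language over a unit-cost random access machine *)

Inductive ivar := vn | vi | vj | vk | vm | vmax.
Inductive iarr := al | ar.
Inductive rarr := aa | af.

Scheme Boolean Equality for ivar.
Scheme Boolean Equality for iarr.
Scheme Boolean Equality for rarr.

Inductive iexp :=
  | ILit of int
  | IVar of ivar
  | IGet of iarr & iexp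
  | IAdd of iexp & iexp
  | ISub of iexp & iexp.

Inductive rexp :=
  | RZero
  | RAlpha
  | RGet of rarr & iexp
  | RAdd of rexp & rexp.

Inductive bexp :=
  | ILt of iexp & iexp
  | ILe of iexp & iexp
  | RLt of rexp & rexp
  | RLe of rexp & rexp
  | BAnd of bexp & bexp.

Inductive cmd :=
  | Skip
  | SetI of ivar & iexp
  | PutI of iarr & iexp & iexp
  | PutR of rarr & iexp & rexp
  | SetNil
  | SetSeg of iexp & iexp
  | Seq of cmd & cmd
  | If of bexp & cmd & cmd
  | While of bexp & cmd.

Record memory (R : realDomainType) := Memory {
  ireg  : ivar -> int;
  imem  : iarr -> int -> int;
  rmem  : rarr -> int -> R;
  alpha_of : R;
  segment_of : option (int * int) }.

Definition set_ireg (R : realDomainType) (s : memory R) (x : ivar) (v : int) : memory R :=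
  Memory (fun y => if ivar_beq x y then v else ireg s y)
    (imem s) (rmem s) (alpha_of s) (segment_of s).

Definition set_imem (R : realDomainType) (s : memory R) (A : iarr) (p v : int) : memory R :=
  Memory (ireg s)
    (fun B q => if iarr_beq A B && (p == q) then v else imem s B q)
    (rmem s) (alpha_of s) (segment_of s).

Definition set_rmem (R : realDomainType) (s : memory R) (A : rarr) (p : int) (v : R) : memory R :=
  Memory (ireg s) (imem s)
    (fun B q => if rarr_beq A B && (p == q) then v else rmem s B q)
    (alpha_of s) (segment_of s).

Definition set_segment (R : realDomainType) (s : memory R) (v : option (int * int)) : memory R :=
  Memory (ireg s) (imem s) (rmem s) (alpha_of s) v.

Fixpoint ieval (R : realDomainType) (s : memory R) (e : iexp) : int :=
  match e with
  | ILit z => z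
  | IVar x => ireg s x
  | IGet A e1 => imem s A (ieval s e1)
  | IAdd e1 e2 => ieval s e1 + ieval s e2
  | ISub e1 e2 => ieval s e1 - ieval s e2
  end.

Fixpoint reval (R : realDomainType) (s : memory R) (e : rexp) : R :=
  match e with
  | RZero => 0
  | RAlpha => alpha_of s
  | RGet A p => rmem s A (ieval s p)
  | RAdd e1 e2 => reval s e1 + reval s e2
  end.

Fixpoint beval (R : realDomainType) (s : memory R) (b : bexp) : bool :=
  match b with
  | ILt e1 e2 => ieval s e1 < ieval s e2
  | ILe e1 e2 => ieval s e1 <= ieval s e2
  | RLt e1 e2 => reval s e1 < reval s e2
  | RLe e1 e2 => reval s e1 <= reval s e2
  | BAnd b1 b2 => beval s b1 && beval s b2
  end.

(* Every literal, variable or array access, arithmetic operation and comparison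
   costs one unit, on indices as well as on reals; [BAnd] is short-circuit. *)

Local Open Scope nat_scope.

Fixpoint icost (e : iexp) : nat :=
  match e with
  | ILit _ | IVar _ => 1
  | IGet _ e1 => (icost e1).+1
  | IAdd e1 e2 | ISub e1 e2 => (icost e1 + icost e2).+1
  end.

Fixpoint rcost (e : rexp) : nat :=
  match e with
  | RZero | RAlpha => 1
  | RGet _ p => (icost p).+1
  | RAdd e1 e2 => (rcost e1 + rcost e2).+1
  end.

Fixpoint bcost (R : realDomainType) (s : memory R) (b : bexp) : nat :=
  match b with
  | ILt e1 e2 | ILe e1 e2 => (icost e1 + icost e2).+1
  | RLt e1 e2 | RLe e1 e2 => (rcost e1 + rcost e2).+1
  | BAnd b1 b2 => (bcost s b1 + (if beval s b1 then bcost s b2 else 0)).+1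
  end.

(* [exec c s t s']: started in memory [s], the command [c] terminates in memory
   [s'] after time [t]. *)
Inductive exec (R : realDomainType) :
    cmd -> memory R -> nat -> memory R -> Prop :=
  | exec_skip s : exec Skip s 0 s
  | exec_seti x e s :
      exec (SetI x e) s (icost e).+1 (set_ireg s x (ieval s e))
  | exec_puti A p e s :
      exec (PutI A p e) s (icost p + icost e).+1
        (set_imem s A (ieval s p) (ieval s e))
  | exec_putr A p e s :
      exec (PutR A p e) s (icost p + rcost e).+1
        (set_rmem s A (ieval s p) (reval s e))
  | exec_setnil s : exec SetNil s 1 (set_segment s None)
  | exec_setseg e1 e2 s :
      exec (SetSeg e1 e2) s (icost e1 + icost e2).+1
        (set_segment s (Some (ieval s e1, ieval s e2)))
  | exec_seq c1 c2 s s1 s2 t1 t2 :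
      exec c1 s t1 s1 -> exec c2 s1 t2 s2 ->
      exec (Seq c1 c2) s (t1 + t2) s2
  | exec_if_true b c1 c2 s s1 t :
      beval s b -> exec c1 s t s1 -> exec (If b c1 c2) s (bcost s b + t).+1 s1
  | exec_if_false b c1 c2 s s1 t :
      ~~ beval s b -> exec c2 s t s1 ->
      exec (If b c1 c2) s (bcost s b + t).+1 s1
  | exec_while_true b c s s1 s2 t1 t2 :
      beval s b -> exec c s t1 s1 -> exec (While b c) s1 t2 s2 ->
      exec (While b c) s (bcost s b + t1 + t2).+1 s2
  | exec_while_false b c s :
      ~~ beval s b -> exec (While b c) s (bcost s b).+1 s.

Local Close Scope nat_scope.

(* Everything in memory other than n, alpha and a_1, ..., a_n is arbitrary at
   the start. *)
Definition holds_input (R : realDomainType) (n : nat) (a : 'I_n -> R) (alpha : R)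
    (s : memory R) : Prop :=
  [/\ ireg s vn = n%:Z, alpha_of s = alpha
    & forall t : 'I_n, rmem s aa (t.+1)%:Z = a t].

(** ** The algorithm *)

Coercion IVar : ivar >-> iexp.

Declare Scope prog_scope.
Delimit Scope prog_scope with prog.
Notation "x ::= e" := (SetI x e) (at level 85, no associativity) : prog_scope.
Notation "c1 ;; c2" := (Seq c1 c2)
  (at level 90, right associativity) : prog_scope.
Local Open Scope prog_scope.

Notation l_ := (IGet al).
Notation r_ := (IGet ar).
Notation a_ := (RGet aa).
Notation f_ := (RGet af).

Definition ForUp (x : ivar) (lo hi : iexp) (c : cmd) : cmd :=
  x ::= lo ;; While (ILe x hi) (c ;; x ::= IAdd x (ILit 1)).

Definition ForDown (x : ivar) (hi lo : iexp) (c : cmd) : cmd :=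
  x ::= hi ;; While (ILe lo x) (c ;; x ::= ISub x (ILit 1)).

Definition PrefixSums : cmd :=
  PutR af (ILit 0) RZero ;;
  ForUp vi (ILit 1) vn
    (PutR af vi (RAdd (f_ (ISub vi (ILit 1))) (a_ vi))).

Definition LeftEnds : cmd :=
  vk ::= ILit 1 ;;
  PutI al (ILit 1) (ILit 0) ;;
  ForUp vi (ILit 1) vn
    (If (RLt (f_ vi) (f_ (l_ vk)))
       (vk ::= IAdd vk (ILit 1) ;; PutI al vk vi)
       Skip).

Definition RightEnds : cmd :=
  vm ::= ILit 1 ;;
  PutI ar (ILit 1) vn ;;
  ForDown vj vn (ILit 1)
    (If (RLt (f_ (r_ vm)) (f_ vj))
       (vm ::= IAdd vm (ILit 1) ;; PutI ar vm vj)
       Skip).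

Definition Sweep : cmd :=
  While (BAnd (ILe vi vk) (ILe (ILit 1) vj))
    (While (BAnd (ILe vi vk) (RLt (f_ (r_ vj)) (RAdd (f_ (l_ vi)) RAlpha)))
       (vi ::= IAdd vi (ILit 1)) ;;
     If (ILe vi vk)
       (While (BAnd (ILe (ILit 1) vj)
                    (RLe (RAdd (f_ (l_ vi)) RAlpha) (f_ (r_ vj))))
          (If (ILt vmax (ISub (r_ vj) (l_ vi)))
             (vmax ::= ISub (r_ vj) (l_ vi) ;;
              SetSeg (IAdd (l_ vi) (ILit 1)) (r_ vj))
             Skip ;;
           vj ::= ISub vj (ILit 1)))
       Skip).

(* The returned value is what [segment_of] holds in the final memory. *)
Definition LongestSegment : cmd :=
  PrefixSums ;;
  LeftEnds ;;
  RightEnds ;;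
  vmax ::= ILit 0 ;;
  SetNil ;;
  vi ::= ILit 1 ;;
  vj ::= vm ;;
  Sweep.

(* Main.v *)
Require Import Defs.
From HB Require Import structures.
From mathcomp Require Import all_boot all_order all_algebra.
From mathcomp Require Import reals.
From mathcomp Require Import zify.

Set Implicit Arguments.
Unset Strict Implicit.
Unset Printing Implicit Defensive.

Import Order.TTheory GRing.Theory Num.Theory.
Local Open Scope ring_scope.

(**
With f_i = a_1 + ... + a_i, a segment [x + 1, y] has score at least alpha iff
f_x + alpha <= f_y.  Moving x left to a strict prefix minimum l_p of f and y
right to a strict suffix maximum r_q of f lengthens the segment without lowering
its score, so only pairs (l_p, r_q) matter.  Both l_p and r_q are monotone and so
are f at l_p and at r_q; hence the two-pointer sweep keeps the invariant that
every feasible pair (p, q) with p < i or q > j has length at most [max]: a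
skipped p is infeasible for all q <= j, and a popped q has its best partner
among p >= i at p = i.  Each round of the sweep moves i or j, so with a time
potential proportional to (k + 1 - i) + j all costs are linear.  As execution is
deterministic, exhibiting one such run suffices.
*)

Lemma exec_deterministic (R : realDomainType) c (s : memory R) t1 s1 t2 s2 :
  exec c s t1 s1 -> exec c s t2 s2 -> t1 = t2 /\ s1 = s2.
Proof.
move=> H; elim: H t2 s2 => {c s t1 s1} *;
  match goal with E : exec _ _ _ _ |- _ => inversion E; subst end => //;
  repeat match goal with
  | IH : forall t s, exec ?c ?s0 t s -> _, E : exec ?c ?s0 _ _ |- _ =>
      have [? ?] := IH _ _ E; subst; clear E
  end => //;
  by match goal with
  | bs : is_true (beval ?s ?b), nbs : is_true (~~ beval ?s ?b) |- _ =>
      rewrite bs in nbs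
  end.
Qed.

Definition runs (R : realDomainType) (c : cmd) (s : memory R)
    (Q : nat -> memory R -> Prop) : Prop :=
  exists t s', exec c s t s' /\ Q t s'.

Section Runs.
Variable R : realDomainType.
Implicit Types (s : memory R) (Q : nat -> memory R -> Prop).

Lemma runs_weaken c s Q Q' :
  runs c s Q -> (forall t s', Q t s' -> Q' t s') -> runs c s Q'.
Proof. by move=> [t [s' [e q]]] h; exists t, s'; split=> //; apply: h. Qed.

Lemma runs_skip s Q : Q 0 s -> runs Skip s Q.
Proof. by exists 0, s; split=> //; constructor. Qed.

Lemma runs_seti x e s Q :
  Q (icost e).+1 (set_ireg s x (ieval s e)) -> runs (SetI x e) s Q.
Proof. by do 2 eexists; split; first by constructor. Qed.

Lemma runs_puti A p e s Q :
  Q (icost p + icost e).+1 (set_imem s A (ieval s p) (ieval s e)) ->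
  runs (PutI A p e) s Q.
Proof. by do 2 eexists; split; first by constructor. Qed.

Lemma runs_putr A p e s Q :
  Q (icost p + rcost e).+1 (set_rmem s A (ieval s p) (reval s e)) ->
  runs (PutR A p e) s Q.
Proof. by do 2 eexists; split; first by constructor. Qed.

Lemma runs_setnil s Q : Q 1 (set_segment s None) -> runs SetNil s Q.
Proof. by do 2 eexists; split; first by constructor. Qed.

Lemma runs_setseg e1 e2 s Q :
  Q (icost e1 + icost e2).+1
    (set_segment s (Some (ieval s e1, ieval s e2))) ->
  runs (SetSeg e1 e2) s Q.
Proof. by do 2 eexists; split; first by constructor. Qed.

Lemma runs_seq c1 c2 s Q :
  runs c1 s (fun t1 s1 => runs c2 s1 (fun t2 s2 => Q (t1 + t2)%N s2)) ->
  runs (Seq c1 c2) s Q.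
Proof.
move=> [t1 [s1 [e1 [t2 [s2 [e2 q]]]]]].
by exists (t1 + t2)%N, s2; split=> //; apply: exec_seq e1 e2.
Qed.

Lemma runs_if b c1 c2 s Q :
  (beval s b -> runs c1 s (fun t s' => Q (bcost s b + t).+1 s')) ->
  (~~ beval s b -> runs c2 s (fun t s' => Q (bcost s b + t).+1 s')) ->
  runs (If b c1 c2) s Q.
Proof.
case: (boolP (beval s b)) => bs.
  move=> /(_ isT) [t [s' [e q]]] _; do 2 eexists; split; last exact: q.
  exact: exec_if_true.
move=> _ /(_ isT) [t [s' [e q]]]; do 2 eexists; split; last exact: q.
exact: exec_if_false.
Qed.

(* [I p s] reads: the invariant holds in [s] and [p] units of time are left.
   The last evaluation of the guard is not paid for by [p]. *)
Lemma runs_while (I : nat -> memory R -> Prop) b c p s :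
  I p s ->
  (forall p s, I p s -> beval s b ->
     runs c s (fun t s' => exists2 p', I p' s' & (bcost s b + t + p' < p)%N)) ->
  runs (While b c) s (fun t s' => exists p',
    [/\ I p' s', ~~ beval s' b & (t + p' <= p + (bcost s' b).+1)%N]).
Proof.
move=> Ip step; have [N] := ubnP p; elim: N p s Ip => // N IH p s Ip ltpN.
case: (boolP (beval s b)) => bs; last first.
  exists (bcost s b).+1, s; split; first exact: exec_while_false.
  by exists p; split=> //; lia.
have [t1 [s1 [e1 [p1 Ip1 lt1]]]] := step _ _ Ip bs.
have [|t2 [s2 [e2 [p2 [Ip2 bs2 lt2]]]]] := IH _ _ Ip1; first by lia.
exists (bcost s b + t1 + t2).+1, s2; split; first exact: exec_while_true e1 e2.
by exists p2; split=> //; lia.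
Qed.

End Runs.

Definition prefix_sum (R : realDomainType) (n : nat) (a : 'I_n -> R) (i : nat) : R :=
  \sum_(t < n | (t < i)%N) a t.

Lemma prefix_sum0 (R : realDomainType) n (a : 'I_n -> R) : prefix_sum a 0 = 0.
Proof. by rewrite /prefix_sum big_pred0. Qed.

Lemma prefix_sumS (R : realDomainType) n (a : 'I_n -> R) (t : 'I_n) :
  prefix_sum a t.+1 = prefix_sum a t + a t.
Proof.
rewrite /prefix_sum (bigD1 t) //= addrC; congr (_ + _).
by apply: eq_bigl => u; rewrite -val_eqE /=; lia.
Qed.

Lemma score_prefix_sum (R : realDomainType) n (a : 'I_n -> R) i j :
  (i < j)%N -> score a i.+1 j = prefix_sum a j - prefix_sum a i.
Proof.
move=> ltij; apply/eqP; rewrite eq_sym subr_eq addrC; apply/eqP.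
rewrite /prefix_sum (bigID (fun t : 'I_n => (t < i)%N)) /=; congr (_ + _).
  by apply: eq_bigl => t; lia.
by apply: eq_bigl => t; lia.
Qed.

Lemma intzS (i : nat) : i%:Z + 1 = i.+1%:Z. Proof. lia. Qed.
Lemma intzP (i : nat) : i.+1%:Z - 1 = i%:Z. Proof. lia. Qed.

Section Correctness.
Variables (R : realDomainType) (n : nat) (a : 'I_n -> R) (alpha : R).
Let F := prefix_sum a.

Definition sums_ready (s : memory R) : Prop :=
  [/\ ireg s vn = n%:Z, alpha_of s = alpha
    & forall i, (i <= n)%N -> rmem s af i%:Z = F i].

Lemma runs_PrefixSums s : holds_input a alpha s ->
  runs PrefixSums s (fun t s' => (t <= 20 * n + 20)%N /\ sums_ready s').
Proof.
move=> [sn sal sa]; rewrite /PrefixSums /ForUp.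
apply/runs_seq/runs_putr/runs_seq/runs_seti => /=.
pose I p (s : memory R) := exists i, [/\ p = (20 * (n.+1 - i))%N,
  (1 <= i <= n.+1)%N, ireg s vi = i%:Z, holds_input a alpha s &
  forall i', (i' < i)%N -> rmem s af i'%:Z = F i'].
apply: runs_weaken.
  apply: (@runs_while _ I _ _ (20 * n)%N).
    exists 1; split=> //=; first by lia.
    by case=> // _; rewrite /F prefix_sum0.
  move=> p {}s [i [-> ibd si [{}sn {}sal {}sa] sf]] /=.
  rewrite si sn => lein.
  apply/runs_seq/runs_putr/runs_seti => /=.
  have [i0 Ei] : exists i0, i = i0.+1 by exists i.-1; lia.
  subst i.
  exists (20 * (n.+1 - i0.+2))%N; last by lia.
  exists i0.+2; split=> //=; first by lia.
  move=> i' lti'; rewrite si; case: eqP => [[<-]|ne]; last by apply: sf; lia.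
  rewrite intzP sf //.
  have lti0 : (i0 < n)%N by lia.
  by rewrite (sa (Ordinal lti0)) -(prefix_sumS a (Ordinal lti0)).
move=> t s' [p' [[i [-> ibd si [sn' sal' sa'] sf]]]] /=.
rewrite si sn' => nlt let_; split; first by lia.
by split=> // i' lei'; apply: sf; lia.
Qed.

Definition left_ends (i k : nat) (l : nat -> nat) : Prop :=
  [/\ (1 <= k <= i.+1)%N,
      forall p, (1 <= p <= k)%N -> (l p <= i)%N,
      forall p q, (1 <= p)%N -> (p < q <= k)%N ->
        (l p < l q)%N /\ F (l q) < F (l p)
    & forall x, (x <= i)%N ->
        exists p, [/\ (1 <= p <= k)%N, (l p <= x)%N & F (l p) <= F x]].

Lemma left_ends0 : left_ends 0 1 (fun=> 0%N).
Proof.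
split=> //; first by move=> p q; lia.
by move=> x; rewrite leqn0 => /eqP->; exists 1%N.
Qed.

Lemma left_ends_skip i k l :
  left_ends i k l -> F (l k) <= F i.+1 -> left_ends i.+1 k l.
Proof.
move=> [kb lb lm lc] h; split=> //; first by lia.
  by move=> p /lb; lia.
move=> x; rewrite leq_eqVlt => /orP[/eqP->|/lc//].
by exists k; split=> //; [lia|rewrite ltnW// ltnS lb//; lia].
Qed.

Lemma left_ends_push i k l : left_ends i k l -> F i.+1 < F (l k) ->
  left_ends i.+1 k.+1 (fun p => if p == k.+1 then i.+1 else l p).
Proof.
move=> [kb lb lm lc] h; split=> //; first by lia.
- by move=> p pb; case: eqP => // ne; rewrite ltnW// ltnS lb//; lia.
- move=> p q p1 pq; have -> : (p == k.+1) = false by lia.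
  case: eqP => [_|ne]; last by apply: lm => //; lia.
  split; first by rewrite ltnS lb//; lia.
  have [->//|ne] := eqVneq p k.
  have [|_] := lm p k p1; first by lia.
  exact: lt_trans.
- move=> x; rewrite leq_eqVlt => /orP[/eqP->|/lc[p [pb lx Fx]]].
    by exists k.+1; rewrite eqxx; split=> //; lia.
  exists p; have -> : (p == k.+1) = false by lia.
  by split=> //; lia.
Qed.

Definition left_ready (k : nat) (l : nat -> nat) (s : memory R) : Prop :=
  [/\ sums_ready s, ireg s vk = k%:Z
    & forall p, (1 <= p <= k)%N -> imem s al p%:Z = (l p)%:Z].

Lemma runs_LeftEnds s : sums_ready s ->
  runs LeftEnds s (fun t s' => (t <= 30 * n + 20)%N /\
    exists k l, left_ends n k l /\ left_ready k l s').
Proof.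
move=> sr; rewrite /LeftEnds /ForUp.
apply/runs_seq/runs_seti/runs_seq/runs_puti/runs_seq/runs_seti => /=.
pose I p (s : memory R) := exists i k l, [/\ p = (30 * (n - i))%N,
  (i <= n)%N, ireg s vi = i.+1%:Z, left_ends i k l & left_ready k l s].
apply: runs_weaken.
  apply: (@runs_while _ I _ _ (30 * n)%N).
    exists 0%N, 1%N, (fun=> 0%N); split=> //=; [lia|exact: left_ends0|].
    by split=> //= p pb; have -> : p = 1%N by lia.
  move=> p {sr}s [i [k [l [-> ibd si le_l [[sn sal sf] sk sl]]]]] /=.
  rewrite si sn => lein.
  have kb : (1 <= k <= k)%N by case: le_l; lia.
  have lkb : (l k <= n)%N by case: le_l => _ /(_ k kb) *; lia.
  apply/runs_seq/runs_if => /=; rewrite si sk (sl k)// !sf//.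
    move=> lt_f; apply/runs_seq/runs_seti/runs_puti/runs_seti => /=.
    exists (30 * (n - i.+1))%N; last by lia.
    exists i.+1, k.+1, (fun p => if p == k.+1 then i.+1 else l p).
    split=> //=; [by rewrite si intzS|exact: left_ends_push|].
    split=> //=; first by rewrite sk intzS.
    move=> p0 pb; rewrite sk si intzS eqz_nat eq_sym.
    by case: eqP => // ne; apply: sl; lia.
  rewrite -leNgt => le_f; apply/runs_skip/runs_seti => /=.
  exists (30 * (n - i.+1))%N; last by lia.
  exists i.+1, k, l; split=> //=; [by rewrite si intzS|exact: left_ends_skip].
move=> t s' [p' [[i [k [l [-> ibd si le_l lr]]]]]] /=.
have [[sn' _ _] _ _] := lr.
rewrite si sn' => nlt let_; split; first by lia.
by exists k, l; have -> : n = i by lia.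
Qed.

(* The state of the downward scan just before index [j] is treated; [r p = j]
   is possible only at the start, since r_1 = n is stored before the scan. *)
Definition right_ends (j m : nat) (r : nat -> nat) : Prop :=
  [/\ (1 <= m)%N && (m + j <= n.+1)%N,
      forall p, (1 <= p <= m)%N -> (j <= r p <= n)%N,
      forall p q, (1 <= p)%N -> (p < q <= m)%N ->
        (r q < r p)%N /\ F (r p) < F (r q)
    & forall y, (j < y <= n)%N ->
        exists p, [/\ (1 <= p <= m)%N, (y <= r p)%N & F y <= F (r p)]].

Lemma right_ends_start : right_ends n 1 (fun=> n).
Proof.
split=> //; first by lia.
- by move=> p _; lia.
- by move=> p q; lia.
- by move=> y; lia.
Qed.

Lemma right_ends_skip j m r :
  right_ends j.+1 m r -> F j.+1 <= F (r m) -> right_ends j m r.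
Proof.
move=> [mb rb rm rc] h; split=> //; first by lia.
  by move=> p /rb; lia.
move=> y yb; have [->|ne] := eqVneq y j.+1; last by apply: rc; lia.
by exists m; split=> //; [lia|have := rb m; lia].
Qed.

Lemma right_ends_push j m r : right_ends j.+1 m r -> F (r m) < F j.+1 ->
  right_ends j m.+1 (fun p => if p == m.+1 then j.+1 else r p).
Proof.
move=> [mb rb rm rc] h.
have jn : (j < n)%N by have := rb m; lia.
have jrm : (j.+1 < r m)%N.
  have := rb m; case: (eqVneq (r m) j.+1) => [E|]; last by lia.
  by rewrite E ltxx in h.
split=> //; first by lia.
- by move=> p pb; case: eqP => ne; [lia|have := rb p; lia].
- move=> p q p1 pq; have -> : (p == m.+1) = false by lia.
  case: eqP => [_|ne]; last by apply: rm => //; lia.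
  have [->//|ne] := eqVneq p m.
  have [|lt_r lt_F] := rm p m p1; first by lia.
  by split; [lia|exact: lt_trans h].
- move=> y yb; have [->|ne] := eqVneq y j.+1.
    by exists m.+1; rewrite eqxx; split=> //; lia.
  have [|p [pb ry Fy]] := rc y; first by lia.
  exists p; have -> : (p == m.+1) = false by lia.
  by split=> //; lia.
Qed.

Definition ends_ready (k : nat) (l : nat -> nat) (m : nat) (r : nat -> nat)
    (s : memory R) : Prop :=
  left_ready k l s /\
  forall q, (1 <= q <= m)%N -> imem s ar q%:Z = (r q)%:Z.

Lemma runs_RightEnds k l s : left_ready k l s ->
  runs RightEnds s (fun t s' => (t <= 30 * n + 20)%N /\
    exists m r, [/\ right_ends 0 m r, ends_ready k l m r s' &
                    ireg s' vm = m%:Z]).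
Proof.
move=> lr; have [[sn _ _] _ _] := lr; rewrite /RightEnds /ForDown.
apply/runs_seq/runs_seti/runs_seq/runs_puti/runs_seq/runs_seti => /=.
pose I p (s : memory R) := exists j m r, [/\ p = (30 * j)%N,
  ireg s vj = j%:Z, right_ends j m r, ends_ready k l m r s &
  ireg s vm = m%:Z].
apply: runs_weaken.
  apply: (@runs_while _ I _ _ (30 * n)%N).
    exists n, 1%N, (fun=> n); split=> //=; first exact: right_ends_start.
    by split=> //= q qb; have -> : q = 1%N by lia.
  move=> p {sn lr}s [j0 [m [r [-> sj re_r [lr sr] sm]]]] /=.
  have [[sn sal sf] sk sl] := lr.
  rewrite sj; case: j0 sj re_r => [|j] sj re_r; first by lia.
  move=> _.
  have mb : (1 <= m <= m)%N by case: re_r; lia.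
  have rmb : (j.+1 <= r m <= n)%N by case: re_r => _ /(_ m mb).
  apply/runs_seq/runs_if => /=; rewrite sj sm (sr m)// !sf//; try lia.
    move=> lt_f; apply/runs_seq/runs_seti/runs_puti/runs_seti => /=.
    exists (30 * j)%N; last by lia.
    exists j, m.+1, (fun p => if p == m.+1 then j.+1 else r p).
    split=> //=; [by rewrite sj intzP|exact: right_ends_push| |].
      split=> //= q qb; rewrite sm sj intzS eqz_nat eq_sym.
      by case: eqP => // ne; apply: sr; lia.
    by rewrite sm intzS.
  rewrite -leNgt => le_f; apply/runs_skip/runs_seti => /=.
  exists (30 * j)%N; last by lia.
  exists j, m, r; split=> //=; [by rewrite sj intzP|exact: right_ends_skip].
move=> t s' [p' [[j [m [r [-> sj re_r er sm]]]]]] /=.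
rewrite sj => nlt let_; split; first by lia.
have j0 : j = 0%N by lia.
by exists m, r; rewrite j0 in re_r; split.
Qed.

Definition best_so_far (out : option (int * int)) (M : nat) : Prop :=
  (out = None /\ M = 0%N) \/
  exists x y, [/\ out = Some (x.+1%:Z, y%:Z), (x < y <= n)%N, M = (y - x)%N
                & F x + alpha <= F y].

Section Sweep.
Variables (k : nat) (l : nat -> nat) (m : nat) (r : nat -> nat).
Hypotheses (le_l : left_ends n k l) (re_r : right_ends 0 m r).

Definition feasible (p q : nat) : bool := F (l p) + alpha <= F (r q).

Definition dominated (i j M : nat) : Prop :=
  forall p q, (1 <= p <= k)%N -> (1 <= q <= m)%N -> feasible p q ->
    (p < i)%N || (j < q)%N -> (r q <= M + l p)%N.

Lemma dominated_skip i j M : (1 <= i <= k)%N -> (1 <= j <= m)%N ->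
  ~~ feasible i j -> dominated i j M -> dominated i.+1 j M.
Proof.
move=> ib jb nf dom p q pb qb fpq.
have [jq _|qj] := ltnP j q; first by apply: dom; rewrite ?jq ?orbT.
rewrite orbF ltnS leq_eqVlt => /orP[/eqP Ep|pi]; last first.
  by apply: dom; rewrite ?pi.
case/negP: nf; subst p; apply: le_trans fpq _.
have [->//|ne] := eqVneq q j.
by have [_ _ mono _] := re_r; have [||_ /ltW//] := mono q j; lia.
Qed.

Lemma dominated_pop i j M M' : (1 <= i <= k)%N -> (1 <= j.+1 <= m)%N ->
  (M <= M')%N -> (r j.+1 <= M' + l i)%N -> dominated i j.+1 M ->
  dominated i j M'.
Proof.
move=> ib jb MM' rM dom p q pb qb fpq.
have [pi _|ip /=] := ltnP p i.
  by apply: leq_trans (dom _ _ pb qb fpq _) _; rewrite ?pi// leq_add2r.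
rewrite leq_eqVlt => /orP[/eqP Eq|jq]; last first.
  by apply: leq_trans (dom _ _ pb qb fpq _) _; rewrite ?jq ?orbT// leq_add2r.
subst q; apply: leq_trans rM _; rewrite leq_add2l.
have [->//|ne] := eqVneq i p.
by have [_ _ mono _] := le_l; have [||/ltnW//] := mono i p; lia.
Qed.

Definition sweep_inv (i j : nat) (s : memory R) : Prop :=
  [/\ ends_ready k l m r s, ireg s vi = i%:Z, ireg s vj = j%:Z
    & exists M, [/\ ireg s vmax = M%:Z, best_so_far (segment_of s) M
                  & dominated i j M]].

Lemma ends_memory s p q : ends_ready k l m r s ->
  (1 <= p <= k)%N -> (1 <= q <= m)%N ->
  [/\ imem s al p%:Z = (l p)%:Z, imem s ar q%:Z = (r q)%:Z,
      rmem s af (l p)%:Z = F (l p) & rmem s af (r q)%:Z = F (r q)].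
Proof.
move=> [[[_ _ sf] _ sl] sr] pb qb; rewrite sl// sr//; split=> //; apply: sf.
  by case: le_l => _ /(_ p pb).
by case: re_r => _ /(_ q qb).
Qed.

Lemma runs_skip_left i j s : (1 <= i <= k)%N -> (1 <= j <= m)%N ->
  sweep_inv i j s ->
  runs (While (BAnd (ILe vi vk) (RLt (f_ (r_ vj)) (RAdd (f_ (l_ vi)) RAlpha)))
         (SetI vi (IAdd vi (ILit 1)))) s
    (fun t s' => exists i', [/\ (i <= i' <= k.+1)%N, sweep_inv i' j s',
        (i' <= k)%N -> feasible i' j & (t <= 40 * (i' - i) + 20)%N]).
Proof.
move=> ib jb inv.
pose I p s := exists i', [/\ p = (40 * (k.+1 - i'))%N,
  (i <= i' <= k.+1)%N & sweep_inv i' j s].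
apply: runs_weaken.
  apply: (@runs_while _ I _ _ (40 * (k.+1 - i))%N).
    by exists i; split=> //; lia.
  move=> p {inv}s [i' [-> ib' [er si sj [M [sM bM dM]]]]] /=.
  have [[[sn sal sf] sk sl] sr] := er.
  rewrite si sj sk sal => /andP[lei'k]; rewrite lei'k.
  have i'b : (1 <= i' <= k)%N by lia.
  have [-> -> -> ->] := ends_memory er i'b jb.
  rewrite ltNge => nf; apply/runs_seti => /=.
  exists (40 * (k.+1 - i'.+1))%N; last by lia.
  exists i'.+1; split=> //; first by lia.
  split=> //=; first by rewrite si intzS.
  by exists M; split=> //; apply: dominated_skip.
move=> t s' [p' [[i' [-> ib' inv']]]].
have [er si sj _] := inv'; have [[[sn sal sf] sk sl] sr] := er.
rewrite /= si sj sk sal => nb let_; exists i'; split=> //; last by case: ifP let_; lia.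
move=> lei'k; have i'b : (1 <= i' <= k)%N by lia.
have [E1 E2 E3 E4] := ends_memory er i'b jb.
move: nb; rewrite E1 E2 E3 E4 negb_and -leNgt -ltNge.
by case/orP=> //; lia.
Qed.

Lemma runs_pop_right i j s : (1 <= i <= k)%N -> (1 <= j <= m)%N ->
  sweep_inv i j s ->
  runs (While (BAnd (ILe (ILit 1) vj)
                    (RLe (RAdd (f_ (l_ vi)) RAlpha) (f_ (r_ vj))))
         (Seq (If (ILt vmax (ISub (r_ vj) (l_ vi)))
                 (Seq (SetI vmax (ISub (r_ vj) (l_ vi)))
                      (SetSeg (IAdd (l_ vi) (ILit 1)) (r_ vj)))
                 Skip)
              (SetI vj (ISub vj (ILit 1))))) s
    (fun t s' => exists j', [/\ (j' <= j)%N, sweep_inv i j' s',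
        (1 <= j')%N -> ~~ feasible i j' & (t <= 40 * (j - j') + 20)%N]).
Proof.
move=> ib jb inv.
pose I p s := exists j', [/\ p = (40 * j')%N, (j' <= j)%N & sweep_inv i j' s].
apply: runs_weaken.
  apply: (@runs_while _ I _ _ (40 * j)%N); first by exists j.
  move=> p {inv}s [j0 [-> jb' [er si sj [M [sM bM dM]]]]] /=.
  have [[[sn sal sf] sk sl] sr] := er.
  rewrite si sj sal => /andP[le1j0]; rewrite le1j0.
  case: j0 le1j0 jb' sj dM => [|j'] // _ jb' sj dM.
  have j'b : (1 <= j'.+1 <= m)%N by lia.
  have [E1 E2 E3 E4] := ends_memory er ib j'b.
  rewrite E1 E2 E3 E4 => fea.
  have rn : (r j'.+1 <= n)%N by case: re_r => _ /(_ _ j'b).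
  apply/runs_seq/runs_if => /=; rewrite si sj E1 E2 sM => ltM.
    apply/runs_seq/runs_seti/runs_setseg/runs_seti => /=.
    exists (40 * j')%N; last by lia.
    exists j'; split=> //; first by lia.
    split=> //=; first by rewrite sj intzP.
    exists (r j'.+1 - l i)%N; split.
    + by rewrite si sj E1 E2; lia.
    + right; exists (l i), (r j'.+1); split=> //; last by lia.
      by rewrite si sj E1 E2 intzS.
    + by apply: dominated_pop dM => //; lia.
  apply/runs_skip/runs_seti => /=.
  exists (40 * j')%N; last by lia.
  exists j'; split=> //; first by lia.
  split=> //=; first by rewrite sj intzP.
  by exists M; split=> //; apply: dominated_pop dM => //; lia.
move=> t s' [p' [[j' [-> jb' inv']]]].
have [er si sj _] := inv'; have [[[sn sal sf] sk sl] sr] := er.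
rewrite /= si sj sal => nb let_; exists j'; split=> //; last by case: ifP let_; lia.
move=> le1j'; have j'b : (1 <= j' <= m)%N by lia.
have [E1 E2 E3 E4] := ends_memory er ib j'b.
by move: nb; rewrite E1 E2 E3 E4 negb_and => /orP[|//]; lia.
Qed.

Lemma runs_Sweep s : sweep_inv 1 m s ->
  runs Sweep s (fun t s' => (t <= 100 * (k + m) + 20)%N /\
    exists i j, [/\ sweep_inv i j s' & (k < i)%N || (j == 0)%N]).
Proof.
move=> inv.
pose I p s := exists i j, [/\ p = (100 * ((k.+1 - i) + j))%N,
  (1 <= i <= k.+1)%N, (j <= m)%N & sweep_inv i j s].
apply: runs_weaken.
  apply: (@runs_while _ I _ _ (100 * (k + m))%N).
    by exists 1%N, m; split=> //; lia.
  move=> p {inv}s [i [j [-> ib jb inv]]].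
  have [er si sj _] := inv; have [[_ sk _] _] := er.
  rewrite /= si sj sk => /andP[leik le1j]; rewrite leik.
  have ib' : (1 <= i <= k)%N by lia.
  have jb' : (1 <= j <= m)%N by lia.
  apply: runs_seq; apply: runs_weaken (runs_skip_left ib' jb' inv) _.
  move=> t1 s1 [i1 [i1b inv1 fea1 let1]].
  have [er1 si1 sj1 _] := inv1; have [[_ sk1 _] _] := er1.
  apply: runs_if => /=; rewrite si1 sk1 => lei1k; last first.
    apply: runs_skip; exists (100 * ((k.+1 - i1) + j))%N; last by lia.
    by exists i1, j; split=> //; lia.
  have i1b' : (1 <= i1 <= k)%N by lia.
  apply: runs_weaken (runs_pop_right i1b' jb' inv1) _.
  move=> t2 s2 [j2 [j2b inv2 nfea2 let2]].
  (* The scan (a) stops at a feasible pair, so that (b) moves j. *)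
  have lt_j : (j2 < j)%N.
    rewrite ltn_neqAle j2b andbT; apply/eqP => Ej.
    subst j2; move/negP: (nfea2 le1j); apply.
    by apply: fea1; lia.
  exists (100 * ((k.+1 - i1) + j2))%N; last by lia.
  by exists i1, j2; split=> //; lia.
move=> t s' [p' [[i [j [-> ib jb inv']]]]].
have [er si sj _] := inv'; have [[_ sk _] _] := er.
rewrite /= si sj sk => nb let_; split; first by case: ifP let_; lia.
by exists i, j; split=> //; lia.
Qed.

(* Any segment extends to one that runs from some l_p to some r_q with at least
   the same score. *)
Lemma ends_cover x y : (x < y <= n)%N -> F x + alpha <= F y ->
  exists p q, [/\ (1 <= p <= k)%N, (1 <= q <= m)%N, feasible p q
                & (y + l p <= r q + x)%N].
Proof.
move=> xyn Fxy.
have [_ _ _ /(_ x) [|p [pb lx Fx]]] := le_l; first by lia.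
have [_ _ _ /(_ y) [|q [qb ry Fy]]] := re_r; first by lia.
exists p, q; split=> //; last by lia.
by apply: le_trans (le_trans Fxy Fy); rewrite lerD2r.
Qed.

Lemma sweep_correct i j s : sweep_inv i j s -> (k < i)%N || (j == 0)%N ->
  correct_answer a alpha (segment_of s).
Proof.
move=> [_ _ _ [M [_ best dom]]] fin.
have optimal x y : (x < y <= n)%N -> F x + alpha <= F y -> (y - x <= M)%N.
  move=> xyn Fxy; have [p [q [pb qb fea ext]]] := ends_cover xyn Fxy.
  by have := dom _ _ pb qb fea; lia.
have seg_optimal i' j' : segment n i' j' -> alpha <= score a i' j' ->
    (0 < j' - i' + 1 <= M)%N.
  case: i' => [|x] /andP[]; first by lia.
  move=> xy yn; rewrite score_prefix_sum; last by lia.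
  rewrite lerBrDl => Fxy.
  by have := optimal x j' _ Fxy; lia.
case: best => [[-> M0]|[x [y [-> xyn EM Fxy]]]].
  right; split=> // -[i' [j' [seg sc]]].
  by have := seg_optimal _ _ seg sc; lia.
left; exists x.+1, y; split=> //; split.
- by rewrite /segment; lia.
- by rewrite score_prefix_sum ?lerBrDl//; lia.
- by move=> i' j' seg sc; have := seg_optimal _ _ seg sc; rewrite /seg_length; lia.
Qed.

End Sweep.

Lemma runs_LongestSegment s : holds_input a alpha s ->
  runs LongestSegment s (fun t s' => (t <= 300 * n + 400)%N /\
    correct_answer a alpha (segment_of s')).
Proof.
move=> input; rewrite /LongestSegment.
apply: runs_seq; apply: runs_weaken (runs_PrefixSums input) _ => t1 s1 [le1 sr].
apply: runs_seq; apply: runs_weaken (runs_LeftEnds sr) _.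
move=> t2 s2 [le2 [k [l [le_l lr]]]].
apply: runs_seq; apply: runs_weaken (runs_RightEnds lr) _.
move=> t3 s3 [le3 [m [r [re_r er sm]]]].
apply/runs_seq/runs_seti/runs_seq/runs_setnil/runs_seq/runs_seti.
apply/runs_seq/runs_seti => /=.
apply: runs_weaken (runs_Sweep le_l re_r _) _.
  split=> //=; exists 0%N; split=> //; first by left.
  by move=> p q pb qb _; lia.
move=> t4 s4 [le4 [i [j [inv fin]]]]; split.
  have [kb _ _ _] := le_l; have [mb _ _ _] := re_r; lia.
exact: sweep_correct inv fin.
Qed.

End Correctness.

Theorem theorem1 (R : realType) :
  exists C : nat,
  forall (n : nat) (a : 'I_n -> R) (alpha : R) (s : memory R),
    (0 < n)%N -> holds_input a alpha s ->
    (exists (t : nat) (s' : memory R), exec LongestSegment s t s') /\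
    (forall (t : nat) (s' : memory R), exec LongestSegment s t s' ->
       (t <= C * n)%N /\ correct_answer a alpha (segment_of s')).
Proof.
exists 1000%N => n a alpha s n0 input.
have [t0 [s0 [e0 [le0 ca]]]] := runs_LongestSegment input.
split; first by exists t0, s0.
move=> t s' e; have [-> ->] := exec_deterministic e e0.
by split=> //; lia.
Qed.
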